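(* Let $G$ be a finite group. The following conditions are equivalent for an element $S\in\mathcal{B}(G)$: (i) $S$ is not a directed geodesic atom. (ii) For all $g\in\mathrm{supp}(S)$ there exists a $T\in\mathcal{GA}(G)$ with $|T|<|S|$ such that $g\in\mathrm{supp}(T)$ and $\mathrm{supp}(T\cdot g^{[-1]})\subseteq\mathrm{supp}(S\cdot g^{[-1]})$. (iii) For all $g\in\mathrm{supp}(S)$ there exists a $T\in\mathcal{A}(G)$ with $|T|<|S|$ such that $g\in\mathrm{supp}(T)$ and $\mathrm{supp}(T\cdot g^{[-1]})\subseteq\mathrm{supp}(S\cdot g^{[-1]})$.
   Context: For a finite group $G$, $\mathcal{F}(G)$ is the free abelian monoid with basis $G$, with operation $\cdot$ (distinct from the product in $G$, which is written by juxtaposition); its elements are called sequences over $G$ (finite multisets of elements of $G$). For $S=g_1\cdot\ldots\cdot g_\ell\in\mathcal{F}(G)$, $|S|=\ell$ is the length, $\mathrm{supp}(S)=\{g_1,\dots,g_\ell\}$ is the set of elements occurring in $S$, and for $g\in\mathrm{supp}(S)$, $S\cdot g^{[-1]}$ denotes the sequence obtained from $S$ by removing one occurrence of $g$. $S$ is a product-one sequence if for some permutation $\pi$ of $\{1,\dots,\ell\}$ we have $g_{\pi(1)}\cdots g_{\pi(\ell)}=1_G$ in $G$; these form a submonoid $\mathcal{B}(G)$ of $\mathcal{F}(G)$. An element $S\in\mathcal{B}(G)$ is an atom if it cannot be written as $S=T\cdot U$ with $T,U\in\mathcal{B}(G)$, $|T|>0$, $|U|>0$; $\mathcal{A}(G)$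 is the set of atoms. For $B\subseteq G$ and $g\in\langle B\rangle$ (the subgroup generated by $B$), $\ell_B(g)$ is the minimal $n\in\mathbb{Z}_{\ge 0}$ such that $g$ is a product of $n$ (not necessarily distinct) elements of $B$ ($\ell_B(1_G)=0$). An element $S\in\mathcal{B}(G)$ is a directed geodesic atom if there exists $g\in\mathrm{supp}(S)$ such that $\ell_{\mathrm{supp}(S\cdot g^{[-1]})}(g^{-1})=|S|-1$; $\mathcal{GA}(G)$ is the set of directed geodesic atoms. *)

(* Defs.v *)
From mathcomp Require Import all_boot all_fingroup finmap multiset.

Set Implicit Arguments.
Unset Strict Implicit.
Unset Printing Implicit Defensive.

Local Open Scope group_scope.
Local Open Scope mset_scope.

(* Sequences over G are multisets [{mset gT}]: the product of sequences is
   [S `+` T], the length |S| is [size S], and removing one occurrence of g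
   from S is [S `\ g]. *)

Section Sequences.

Variable gT : finGroupType.
Implicit Types (B : {set gT}) (g : gT) (S T U : {mset gT}).

Definition supp S : {set gT} := [set x in S].

Definition product_one S : Prop :=
  exists2 s : seq gT, perm_eq s S & \prod_(x <- s) x = 1.

(* No condition S <> mset0 is imposed, so the empty sequence satisfies
   [atom]. *)
Definition atom S : Prop :=
  product_one S /\
  ~ (exists T U, [/\ product_one T, product_one U, (0 < size T)%N,
                     (0 < size U)%N & S = T `+` U]).

Definition is_prod_of B (n : nat) g : bool :=
  [exists t : n.-tuple gT, all (mem B) t && (\prod_(x <- t) x == g)].

(* Inverses of elements of B need not be allowed in the products, as gT is
   finite. *)
Lemma gen_is_prod_of B g : g \in <<B>> -> exists n, is_prod_of B n g.
Proof.
case/gen_prodgP=> n [c Bc ->]; exists n; apply/existsP.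
exists [tuple c i | i < n]; apply/andP; split.
  by apply/allP=> _ /mapP[i _ ->]; apply: Bc.
by rewrite big_tuple; apply/eqP/eq_bigr=> i _; rewrite tnth_mktuple.
Qed.

(* The directed word length is only defined on the subgroup generated by B,
   hence the membership proof as an argument. *)
Definition word_length B g (Bg : g \in <<B>>) : nat :=
  ex_minn (gen_is_prod_of Bg).

(* For a product-one S and g in its support, the membership of g^-1 in the
   generated subgroup is automatic. *)
Definition directed_geodesic_atom S : Prop :=
  product_one S /\
  exists2 g, g \in supp S &
    exists Sg : g^-1 \in <<supp (S `\ g)>>,
      word_length Sg = (size S - 1)%N.

End Sequences.

(* Main.v *)
(* For g in the support of a product-one sequence T, cyclically permuting a
   product-one ordering of T so that it starts with g writes g^-1 as a product
   of |T| - 1 elements of supp (T \ g). Conversely, prepending g to a shortest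
   word for g^-1 over supp (S \ g) yields a directed geodesic atom. *)
Require Import Defs.
From mathcomp Require Import all_boot all_fingroup finmap multiset.

Local Open Scope mset_scope.

Section DirectedGeodesicAtoms.

Set Implicit Arguments.
Unset Strict Implicit.

Variable gT : finGroupType.
Implicit Types (B C : {set gT}) (g : gT) (S T U : {mset gT}) (s t : seq gT).

Lemma mem_supp S g : (g \in supp S) = (g \in S).
Proof. by rewrite inE. Qed.

Lemma supp_sub S B : {subset S <= B} -> supp S \subset B.
Proof. by move=> sSB; apply/subsetP=> x; rewrite mem_supp => /sSB. Qed.

Lemma is_prod_ofP B n g :
  reflect (exists t, [/\ size t = n, {subset t <= B} & (\prod_(x <- t) x = g)%g])
          (is_prod_of B n g).
Proof.
apply: (iffP existsP) => [[t /andP[/allP tB /eqP tg]]|[t [tn tB tg]]].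
  by exists t; rewrite size_tuple.
have tn' : size t == n by rewrite tn.
exists (Tuple tn') => /=; apply/andP; split; first exact/allP.
exact/eqP.
Qed.

Lemma is_prod_ofS B C n g :
  B \subset C -> is_prod_of B n g -> is_prod_of C n g.
Proof.
move=> /subsetP sBC /is_prod_ofP[t [tn tB tg]]; apply/is_prod_ofP.
by exists t; split=> // x /tB/sBC.
Qed.

Lemma is_prod_of_mem_gen B n g : is_prod_of B n g -> g \in <<B>>%g.
Proof.
case/is_prod_ofP=> t [_ tB <-]; rewrite big_seq; apply: group_prod => x /tB.
exact: mem_gen.
Qed.

Lemma word_length_prod B g (Bg : g \in <<B>>%g) :
  is_prod_of B (word_length Bg) g.
Proof. by rewrite /word_length; case: ex_minnP. Qed.

Lemma word_length_le B g (Bg : g \in <<B>>%g) n :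
  is_prod_of B n g -> (word_length Bg <= n)%N.
Proof. by rewrite /word_length; case: ex_minnP => m _ min_m /min_m. Qed.

Lemma size_seq_mset s : size (seq_mset s) = size s.
Proof. exact/perm_size/perm_eq_seq_mset. Qed.

Lemma size_mset1D g T : size (g +` T) = (size T).+1.
Proof. by rewrite -[T]seq_mset_id -mset_cons !size_seq_mset. Qed.

Lemma size_msetD S T : size (S `+` T) = (size S + size T)%N.
Proof.
have -> : S `+` T = seq_mset (S ++ T).
  apply/msetP=> x; rewrite mset_seqE count_cat !msetE2.
  by rewrite -!mset_seqE !seq_mset_id.
by rewrite size_seq_mset size_cat.
Qed.

Lemma product_one_cons g t :
  (\prod_(x <- t) x = g^-1)%g -> product_one (g +` seq_mset t).
Proof.
move=> tg; exists (g :: t); last by rewrite big_cons tg mulgV.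
by rewrite -mset_cons perm_sym perm_eq_seq_mset.
Qed.

Lemma product_one_rot T g : product_one T -> g \in T ->
  exists2 t, (\prod_(x <- t) x = g^-1)%g & T = g +` seq_mset t.
Proof.
move=> [s sT s1] gT_; have /rot_to[i t st] : g \in s by rewrite (perm_mem sT).
exists t.
  apply/eqP; rewrite eq_sym eq_invg_mul -(big_cons _ _ g t xpredT id) -st.
  (* The two blocks of the rotation are swapped back: a product of two factors is 1 exactly when
     they are mutually inverse, and this is symmetric in the factors. *)
  rewrite /rot big_cat /= -eq_invg_mul eq_invg_sym eq_sym eq_invg_mul.
  by rewrite -big_cat cat_take_drop s1.
rewrite -mset_cons -st -[LHS]seq_mset_id; apply/eq_seq_msetP.
by rewrite perm_sym perm_rot.
Qed.

Lemma product_one_is_prod_of T g : product_one T -> g \in T ->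
  is_prod_of (supp (T `\ g)) (size T).-1 g^-1.
Proof.
move=> T1 /(product_one_rot T1)[t tg ->]; apply/is_prod_ofP; exists t.
rewrite size_mset1D size_seq_mset; split=> // x xt.
by rewrite mem_supp msetD1K (perm_mem (perm_eq_seq_mset t)).
Qed.

(** Trades the dependent membership proof and the equality of lengths for a lower bound alone. The
    opposite bound is automatic, since a rotated product-one ordering is already a word of length
    |S| - 1. *)
Lemma directed_geodesic_atomP S : directed_geodesic_atom S <->
  product_one S /\ exists2 g, g \in S &
    forall n, is_prod_of (supp (S `\ g)) n g^-1 -> ((size S).-1 <= n)%N.
Proof.
split=> -[S1 [g gS gP]]; split=> //; exists g; rewrite ?mem_supp // in gS *.
  by case: gP => Sg; rewrite subn1 => <- n; apply: word_length_le.
(* This one word yields both the membership of [g^-1] in the generated subgroup and the upper bound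
   on its length. *)
have Sg := product_one_is_prod_of S1 gS.
exists (is_prod_of_mem_gen Sg); apply/eqP; rewrite subn1 eqn_leq.
by rewrite word_length_le // gP // word_length_prod.
Qed.

(** In a proper factorization, the factor containing [g] would give a word for [g^-1] that is too
    short. *)
Lemma directed_geodesic_atom_atom S : directed_geodesic_atom S -> atom S.
Proof.
case/directed_geodesic_atomP=> S1 [g gS min_S]; split=> // -[T [U]].
wlog gT_ : T U / g \in T => [IH|] [T1 U1 T_gt0 U_gt0 defS].
  have /msetDP[gT_|gU] : g \in T `+` U by rewrite -defS.
    exact: (IH T U).
  by apply: (IH U T gU); split=> //; rewrite msetDC.
have /min_S : is_prod_of (supp (S `\ g)) (size T).-1 g^-1.
  apply: is_prod_ofS (product_one_is_prod_of T1 gT_).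
  (* Multiplicities are compared, as [g] itself may survive its removal; adding [U] can only
     increase them. *)
  apply: supp_sub => x; rewrite mem_supp !in_mset defS => /leq_trans-> //.
  by rewrite !msetE2 leq_sub2r // leq_addr.
by rewrite defS size_msetD leqNgt -!subn1 ltn_sub2rE // -addn1 leq_add2l U_gt0.
Qed.

(** The given word need not be shortest, so it is replaced by a shortest one over [B]. That word
    remains shortest over its own letters, because any word in them is also a word over [B]. *)
Lemma short_word_directed_geodesic_atom B g n : is_prod_of B n g^-1 ->
  exists T, [/\ directed_geodesic_atom T, (size T <= n.+1)%N, g \in T
              & supp (T `\ g) \subset B].
Proof.
move=> Bn; have Bg := is_prod_of_mem_gen Bn.
have /is_prod_ofP[t [tn tB tg]] := word_length_prod Bg.
have sTB : supp ((g +` seq_mset t) `\ g) \subset B.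
  by apply: supp_sub => x; rewrite msetD1K (perm_mem (perm_eq_seq_mset t)) => /tB.
have szT : size (g +` seq_mset t) = (word_length Bg).+1.
  by rewrite size_mset1D size_seq_mset tn.
exists (g +` seq_mset t); split=> //; last exact: mset1D1.
  apply/directed_geodesic_atomP; split; first exact: product_one_cons.
  exists g => [|m /(is_prod_ofS sTB)]; first exact: mset1D1.
  by rewrite szT; apply: word_length_le.
by rewrite szT ltnS word_length_le.
Qed.

End DirectedGeodesicAtoms.

Theorem theorem6p1 (gT : finGroupType) (S : {mset gT}) (hS : product_one S) :
  [<-> ~ directed_geodesic_atom S;
       forall g : gT, g \in supp S ->
         exists T : {mset gT},
           [/\ directed_geodesic_atom T, (size T < size S)%N, g \in supp T
             & supp (T `\ g) \subset supp (S `\ g)];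
       forall g : gT, g \in supp S ->
         exists T : {mset gT},
           [/\ atom T, (size T < size S)%N, g \in supp T
             & supp (T `\ g) \subset supp (S `\ g)]].
Proof.
tfae=> [S'GA g|SGA g /SGA[T [TGA ltTS gT_ sTS]]|SA].
- rewrite mem_supp => gS.
  have [n Sn ltnS] : exists2 n, is_prod_of (supp (S `\ g)) n g^-1
                              & (n < (size S).-1)%N.
    have Sg := is_prod_of_mem_gen (product_one_is_prod_of hS gS).
    exists (word_length Sg); first exact: word_length_prod.
    (* Otherwise this very [g] would witness that [S] is a directed geodesic atom. *)
    rewrite ltnNge; apply/negP=> leS; apply: S'GA.
    apply/directed_geodesic_atomP; split=> //; exists g => // n.
    by move/(word_length_le Sg); apply: leq_trans.
  have [T [TGA leT gT_ sTS]] := short_word_directed_geodesic_atom Sn.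
  exists T; rewrite mem_supp; split=> //.
  by apply: leq_ltn_trans leT _; rewrite -ltn_predRL.
- by exists T; split=> //; apply: directed_geodesic_atom_atom.
- case/directed_geodesic_atomP=> _ [g gS min_S].
  have /SA[T [[T1 _] ltTS]] : g \in supp S by rewrite mem_supp.
  rewrite mem_supp => gT_ sTS.
  have := min_S _ (is_prod_ofS sTS (product_one_is_prod_of T1 gT_)).
  (* Positivity keeps the inequality |T| < |S| strict under truncated subtraction of 1, which
     contradicts the minimality for [S]. *)
  have T_gt0 : (0 < size T)%N.
    by case/product_one_rot: gT_ => // t _ ->; rewrite size_mset1D.
  by rewrite leqNgt -!subn1 ltn_sub2rE // ltTS.
Qed.
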